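(* Fix $M\ge 1$ and $c>0$, and let $G=(V,E)$ be a finite simple undirected graph with clique-degree $D$ whose growth is bounded by $$f(r)=c\left(1+\frac{1}{4DM}\right)^r,$$ i.e. $S_r(G,i)\le f(r)$ for every vertex $i\in V$ and every integer $r\ge0$. Then for every integral graphical potential game on $G$ with $M$-bounded local potentials, the number of updates of every player along every better-response path is at most $8cD^2M^2$.
   Context: A game has a finite player set $V$; each player $i\in V$ has a finite strategy set $\mathcal{S}_i$; $\mathcal{S}=\prod_{i\in V}\mathcal{S}_i$ is the set of strategy profiles; player $i$ has a utility $u_i\colon\mathcal{S}\to\mathbb{R}$. It is a graphical game on $G$ if each $u_i(a)$ depends only on the strategies of $i$ and of the neighbors of $i$ in $G$. It is a potential game with potential $\Phi\colon\mathcal{S}\to\mathbb{R}$ if $u_i(b)-u_i(a)=\Phi(b)-\Phi(a)$ whenever $a,b\in\mathcal{S}$ differ only in coordinate $i$. A graphical potential game on $G$ is a game that is both. $\mathcal{C}(G)$ is the set of maximal cliques of $G$ (cliques not contained in strictly larger cliques; an isolated vertex is a maximal clique). For $C\subseteq V$, $a^C$ is the restriction of $a\in\mathcal{S}$ to $C$. The potential (not required to be normalized in any way) comes with a decomposition $\Phi(a)=\sum_{C\in\mathcal{C}(G)}\Phi^C(a^C)$ into local potentials $\Phi^C\colon\prod_{i\in C}\mathcal{S}_i\to\mathbb{R}$. The game has $M$-bounded local potentials if $|\Phi^C(a^C)|\le M$ for all $C$ and all $a^C$, and is integral if all local potentials (of this decomposition) take only integer values. The clique-degree of $G$ is the largest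 number of maximal cliques to which any single vertex belongs. A better-response path of length $L$ is a sequence of profiles $(a(t))_{t=0}^{L}$ such that for each $t<L$, $a(t+1)$ differs from $a(t)$ in exactly one coordinate $i=i(t)$ and $u_{i}(a(t+1))>u_{i}(a(t))$; player $i(t)$ is said to update her strategy at time $t$. $S_r(G,i)$ is the number of vertices at graph distance exactly $r$ from $i$ in $G$. *)

(* Defs.v *)
From HB Require Import structures.
From mathcomp Require Import all_boot all_order all_algebra.
From mathcomp Require Import reals.

Set Implicit Arguments.
Unset Strict Implicit.
Unset Printing Implicit Defensive.

Import Order.TTheory GRing.Theory Num.Theory.
Local Open Scope ring_scope.

(* A finite simple graph is a symmetric irreflexive relation e on V : finType. *)
Section Graphs.
Variables (V : finType) (e : rel V).

Definition is_clique (C : {set V}) : bool :=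
  [forall x in C, forall y in C, (x != y) ==> e x y].

Definition max_clique (C : {set V}) : bool := maxset is_clique C.

Definition clique_degree : nat :=
  \max_(v : V) #|[set C : {set V} | max_clique C & v \in C]|.

Definition has_walk (r : nat) (i j : V) : bool :=
  [exists p : r.-tuple V, path e i p && (last i p == j)].

Definition at_distance (r : nat) (i j : V) : bool :=
  has_walk r i j && [forall k : 'I_r, ~~ has_walk k i j].

Definition sphere (r : nat) (i : V) : {set V} := [set j | at_distance r i j].

End Graphs.

Section Games.
Variables (R : realType) (V : finType) (S : V -> finType).

Definition profile := {dffun forall i : V, S i}.

Definition local_profile (C : {set V}) :=
  {dffun forall i : {i : V | i \in C}, S (val i)}.

Definition restrict (C : {set V}) (a : profile) : local_profile C :=
  [ffun i : {i : V | i \in C} => a (val i)].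

Definition graphical_game (e : rel V) (u : V -> profile -> R) : Prop :=
  forall (i : V) (a b : profile),
    (forall j : V, (j == i) || e i j -> a j = b j) -> u i a = u i b.

Definition potential_game (u : V -> profile -> R) (Phi : profile -> R) : Prop :=
  forall (i : V) (a b : profile),
    (forall j : V, j != i -> a j = b j) -> u i b - u i a = Phi b - Phi a.

(* Local potentials are indexed by all sets C; only their values at maximal
   cliques are ever used. *)
Definition decomposes (e : rel V) (Phi : profile -> R)
    (phi : forall C : {set V}, local_profile C -> R) : Prop :=
  forall a : profile, Phi a = \sum_(C | max_clique e C) phi C (restrict C a).

Definition bounded_local_potentials (e : rel V) (M : R)
    (phi : forall C : {set V}, local_profile C -> R) : Prop :=
  forall C : {set V}, max_clique e C ->
    forall x : local_profile C, `|phi C x| <= M.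

Definition integral_local_potentials (e : rel V)
    (phi : forall C : {set V}, local_profile C -> R) : Prop :=
  forall C : {set V}, max_clique e C ->
    forall x : local_profile C, phi C x \is a Num.int.

Definition differ_exactly_at (i : V) (a b : profile) : bool :=
  [forall j : V, (a j != b j) == (j == i)].

(* A path of length L is read off the values a 0, ..., a L of a sequence; the
   later values are irrelevant. *)
Definition better_response_path (u : V -> profile -> R) (L : nat)
    (a : nat -> profile) : Prop :=
  forall t : nat, (t < L)%N ->
    exists i : V,
      differ_exactly_at i (a t) (a t.+1) /\ u i (a t) < u i (a t.+1).

Definition num_updates (i : V) (L : nat) (a : nat -> profile) : nat :=
  #|[set t : 'I_L | differ_exactly_at i (a t) (a t.+1)]|.

End Games.

(* Main.v *)
Require Import Defs.
From HB Require Import structures.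
From mathcomp Require Import all_boot all_order all_algebra.
From mathcomp Require Import reals.
From mathcomp Require Import ring lra.

Set Implicit Arguments.
Unset Strict Implicit.
Unset Printing Implicit Defensive.

Import Order.TTheory GRing.Theory Num.Theory.
Local Open Scope ring_scope.

(* Put x = 1/(4DM), give the vertex j the weight w_j = (1+4x)^-dist(i,j) (zero
   if j is not connected to i), give a clique C the largest weight w_C of its
   vertices, and follow the weighted potential Psi = sum_C w_C Phi^C.  When j
   updates, integrality makes Phi grow by at least 1, and only the at most D
   cliques containing j contribute, each by at most 2M in absolute value.
   These cliques have w_j <= w_C <= (1+4x) w_j; comparing w_C with the midpoint
   (1+2x) w_j shows that Psi grows by at least
   (1+2x) w_j - D (2x w_j) (2M) = 2x w_j >= 0.
   When j = i all these w_C are 1, so Psi grows by at least 1.  Hence i updates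
   at most max Psi - min Psi <= 2M sum_C w_C <= 2MD sum_j w_j times, and the
   last sum is dominated by the geometric series sum_r c ((1+x)/(1+4x))^r,
   which is at most c/x. *)

(** * Walks and distances from a vertex *)

Section Distance.
Variables (V : finType) (e : rel V) (i : V).

Lemma has_walk_at_distance (r : nat) (j : V) :
  has_walk e r i j -> exists2 d, (d <= r)%N & at_distance e d i j.
Proof.
move=> wr; have ex : exists d, has_walk e d i j by exists r.
case: (ex_minnP ex) => d wd dmin; exists d; first exact: dmin.
rewrite /at_distance wd; apply/forallP => k; apply/negP => /dmin.
by rewrite leqNgt ltn_ord.
Qed.

Lemma at_distance_inj (r s : nat) (j : V) :
  at_distance e r i j -> at_distance e s i j -> r = s.
Proof.
move=> /andP[wr /forallP minr] /andP[ws /forallP mins].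
case: (ltngtP r s) => // [lt_rs|lt_sr].
- by have := mins (Ordinal lt_rs); rewrite wr.
- by have := minr (Ordinal lt_sr); rewrite ws.
Qed.

(** Shortening a walk to one without repeated vertices leaves fewer than [#|V|] edges; hence sums
    over distances may stop at [#|V|]. *)
Lemma at_distance_lt_card (r : nat) (j : V) :
  at_distance e r i j -> (r < #|V|)%N.
Proof.
move=> /andP[/existsP[p /andP[ep /eqP lastp]] /forallP minr].
case/shortenP: ep lastp => q eq uq _ lq.
have lt_q : (size q < #|V|)%N.
  by have := max_card (mem (i :: q)); rewrite (card_uniqP uq).
have wq : has_walk e (size q) i j.
  by apply/existsP; exists (in_tuple q); rewrite /= eq lq eqxx.
have [lt_qr|le_rq] := ltnP (size q) r.
- by have := minr (Ordinal lt_qr); rewrite wq.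
- exact: leq_ltn_trans le_rq lt_q.
Qed.

Lemma at_distance0 : at_distance e 0 i i.
Proof.
apply/andP; split; last by apply/forallP => -[].
by apply/existsP; exists [tuple] => /=.
Qed.

Lemma has_walk_step (r : nat) (j k : V) :
  e j k -> has_walk e r i j -> has_walk e r.+1 i k.
Proof.
move=> ejk /existsP[p /andP[ep /eqP lp]].
apply/existsP; exists [tuple of rcons p k].
by rewrite /= rcons_path ep lp ejk last_rcons eqxx.
Qed.

End Distance.

(** * Weights decaying geometrically with the distance *)

Section DistanceWeight.
Variables (R : realType) (V : finType) (e : rel V) (i : V) (nu : R).
Hypotheses (nu_ge0 : 0 <= nu) (nu_le1 : nu <= 1).

(* This is nu ^+ dist(i, j), and 0 when j is not reachable from i. *)
Definition dist_weight (j : V) : R :=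
  \sum_(r < #|V|) (at_distance e r i j)%:R * nu ^+ r.

Lemma dist_weightE (r : nat) (j : V) :
  at_distance e r i j -> dist_weight j = nu ^+ r.
Proof.
move=> hr; rewrite /dist_weight (bigD1 (Ordinal (at_distance_lt_card hr))) //=.
rewrite hr mul1r big1 ?addr0 // => s ne.
have [hs|] := boolP (at_distance e s i j); last by rewrite mul0r.
by case/eqP: ne; apply: val_inj; exact: (at_distance_inj hs hr).
Qed.

Lemma dist_weight_ge0 (j : V) : 0 <= dist_weight j.
Proof. by apply: sumr_ge0 => r _; rewrite mulr_ge0 ?exprn_ge0. Qed.

Lemma dist_weight_center : dist_weight i = 1.
Proof. by rewrite (dist_weightE (at_distance0 e i)) expr0. Qed.

Variant dist_weight_spec (j : V) : R -> Prop :=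
  | DistWeightReach r of at_distance e r i j : dist_weight_spec j (nu ^+ r)
  | DistWeightUnreach : dist_weight_spec j 0.

Lemma dist_weightP (j : V) : dist_weight_spec j (dist_weight j).
Proof.
have [/existsP[r hr]|/existsPn no] :=
  boolP [exists r : 'I_#|V|, at_distance e r i j].
- by rewrite (dist_weightE hr); exact: DistWeightReach.
- rewrite /dist_weight big1; first exact: DistWeightUnreach.
  by move=> r _; rewrite (negbTE (no r)) mul0r.
Qed.

Lemma dist_weight_le1 (j : V) : dist_weight j <= 1.
Proof. by case: dist_weightP => [r _|//]; rewrite exprn_ile1. Qed.

(** An edge raises the distance from [i] by at most 1, and powers of [nu] decrease in the exponent;
    an unreachable [j] has weight 0. *)
Lemma dist_weight_step (j k : V) :
  e j k -> nu * dist_weight j <= dist_weight k.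
Proof.
move=> ejk; case: (dist_weightP j) => [r /andP[wr _]|]; last first.
  by rewrite mulr0 dist_weight_ge0.
have [d led hd] := has_walk_at_distance (has_walk_step ejk wr).
by rewrite (dist_weightE hd) -exprS ler_wiXn2l.
Qed.

Lemma sum_dist_weight :
  \sum_j dist_weight j = \sum_(r < #|V|) #|sphere e r i|%:R * nu ^+ r.
Proof.
rewrite exchange_big /=; apply: eq_bigr => r _.
rewrite -mulr_suml -natr_sum; congr (_%:R * _).
rewrite -[RHS]sum1_card [RHS]big_mkcond /=.
by apply: eq_bigr => j _; rewrite inE; case: at_distance.
Qed.

End DistanceWeight.

(** * Geometric sums and maximal cliques *)

Lemma sum_geometric_le (R : realType) (q b : R) (n : nat) :
  0 <= q < 1 -> 1 <= (1 - q) * b -> \sum_(r < n) q ^+ r <= b.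
Proof.
move=> /andP[q0 q1] hb; have qn : 0 <= q ^+ n by rewrite exprn_ge0.
(* Multiplied by [1 - q], the sum becomes [1 - q ^+ n]. *)
rewrite -(@ler_pM2l _ (1 - q)) ?subr_gt0 //; apply: le_trans hb.
by have := subrX1 q n; lra.
Qed.

(** The clique [[set i]] extends to a maximal one. This makes the denominator [4DM] of the growth
    rate positive. *)
Lemma clique_degree_gt0 (V : finType) (e : rel V) (i : V) :
  (0 < clique_degree e)%N.
Proof.
have ci : is_clique e [set i].
  apply/forall_inP => x; rewrite inE => /eqP ->.
  by apply/forall_inP => y; rewrite inE => /eqP ->; rewrite eqxx.
have [C maxC iC] := maxset_exists ci.
apply: leq_trans (leq_bigmax i); rewrite card_gt0; apply/set0Pn; exists C.
by rewrite inE /max_clique maxC -sub1set.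
Qed.

Lemma max_clique_edge (V : finType) (e : rel V) (C : {set V}) (j k : V) :
  max_clique e C -> j \in C -> k \in C -> j != k -> e j k.
Proof.
move=> /maxsetp /forall_inP cl jC kC jk.
by have /forall_inP/(_ k kC)/implyP/(_ jk) := cl j jC.
Qed.

(** * Weights of cliques *)

Section CliqueWeight.
Variables (R : realType) (V : finType) (w : V -> R).
Hypothesis w_ge0 : forall j, 0 <= w j.

Definition clique_weight (C : {set V}) : R := \big[Num.max/0]_(k in C) w k.

Lemma clique_weight_ge (C : {set V}) (j : V) : j \in C -> w j <= clique_weight C.
Proof. by move=> jC; rewrite /clique_weight; exact: le_bigmax_cond. Qed.

Lemma clique_weight_le (C : {set V}) (b : R) :
  0 <= b -> (forall k, k \in C -> w k <= b) -> clique_weight C <= b.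
Proof. by move=> b0 hb; apply: bigmax_le. Qed.

Lemma clique_weight_ge0 (C : {set V}) : 0 <= clique_weight C.
Proof. exact: bigmax_ge_id. Qed.

(** Bound each maximum by the sum over the clique, then count pairs of a vertex and a maximal clique
    containing it. *)
Lemma sum_clique_weight (e : rel V) :
  \sum_(C | max_clique e C) clique_weight C
    <= (clique_degree e)%:R * \sum_j w j.
Proof.
apply: (@le_trans _ _ (\sum_(C | max_clique e C) \sum_(k in C) w k)).
  apply: ler_sum => C _; apply: clique_weight_le => [|k kC].
    exact: sumr_ge0.
  by rewrite (bigD1 k) //= lerDl sumr_ge0.
rewrite (exchange_big_dep predT) //= mulr_sumr; apply: ler_sum => j _.
rewrite sumr_const -[leLHS]mulr_natl ler_wpM2r // ler_nat.
rewrite (leq_trans _ (leq_bigmax j)) //.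
by apply/eq_leq/eq_card => C; rewrite inE.
Qed.

End CliqueWeight.

(** * The weighted potential: its range and its growth along a path *)

Section WeightedPotential.
Variables (R : realType) (V : finType) (e : rel V) (S : V -> finType).
Variables (phi : forall C : {set V}, local_profile S C -> R) (M : R).
Hypothesis hbounded : bounded_local_potentials e M phi.

Definition weighted_potential (om : {set V} -> R) (a : profile S) : R :=
  \sum_(C | max_clique e C) om C * phi (restrict C a).

Lemma local_potential_diff (C : {set V}) (x y : local_profile S C) :
  max_clique e C -> `|phi x - phi y| <= 2 * M.
Proof.
move=> mC; apply: le_trans (ler_normB _ _) _.
have := hbounded mC x; have := hbounded mC y; lra.
Qed.

Lemma weighted_potential_range (om : {set V} -> R) (a b : profile S) :
  (forall C, 0 <= om C) ->
  weighted_potential om b - weighted_potential om a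
    <= 2 * M * \sum_(C | max_clique e C) om C.
Proof.
move=> om0; rewrite /weighted_potential -sumrB mulr_sumr.
apply: ler_sum => C mC; rewrite -mulrBr mulrC ler_wpM2r //.
exact: le_trans (ler_norm _) (local_potential_diff _ _ mC).
Qed.

Variables (u : V -> profile S -> R) (Phi : profile S -> R).
Hypotheses (hpotential : potential_game u Phi) (hdecomp : decomposes e Phi phi).
Hypothesis hintegral : integral_local_potentials e phi.

Lemma better_response_gain (j : V) (a b : profile S) :
  differ_exactly_at j a b -> u j a < u j b -> 1 <= Phi b - Phi a.
Proof.
move=> /forallP dab lt_u.
have int_Phi (s : profile S) : Phi s \is a Num.int.
  by rewrite hdecomp rpred_sum // => C mC; exact: hintegral.
have gt0 : 0 < Phi b - Phi a.
  rewrite -(hpotential (i := j)) ?subr_gt0 // => k kj.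
  by have := dab k; rewrite (negbTE kj) => /eqP /negbT /negPn /eqP.
rewrite -(gtr0_norm gt0) norm_intr_ge1 ?gt_eqF //.
by rewrite rpredB.
Qed.

(** Split [om C] as [beta + (om C - beta)]: the constant part gains at least [beta] because [Phi]
    gains at least 1, and the rest is an error term coming only from cliques through [j]. *)
Lemma weighted_potential_gain (om : {set V} -> R) (beta delta : R)
    (j : V) (a b : profile S) :
  0 <= M -> 0 <= beta -> 0 <= delta ->
  (forall C, max_clique e C -> j \in C -> `|om C - beta| <= delta) ->
  differ_exactly_at j a b -> u j a < u j b ->
  beta - (clique_degree e)%:R * (delta * (2 * M))
    <= weighted_potential om b - weighted_potential om a.
Proof.
move=> M0 beta0 delta0 hom dab lt_u.
pose d C := phi (restrict C b) - phi (restrict C a).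
have d0 (C : {set V}) : j \notin C -> d C = 0.
  move=> jC; apply/eqP; rewrite subr_eq0; apply/eqP; congr phi.
  apply/ffunP => -[k kC]; rewrite !ffunE /=.
  have /forallP/(_ k) := dab; have -> : (k == j) = false.
    by apply: contraNF jC => /eqP <-.
  by move=> /eqP /negbT /negPn /eqP.
have sum_d : 1 <= \sum_(C | max_clique e C) d C.
  by rewrite sumrB -!hdecomp; exact: better_response_gain dab lt_u.
have -> : weighted_potential om b - weighted_potential om a =
    beta * (\sum_(C | max_clique e C) d C)
    + \sum_(C | max_clique e C) (om C - beta) * d C.
  rewrite /weighted_potential -sumrB mulr_sumr -big_split /=.
  by apply: eq_bigr => C _; rewrite /d; ring.
apply: lerD; first by rewrite ler_peMr.
rewrite lerNl; apply: le_trans (ler_norm _) _; rewrite normrN.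
apply: le_trans (ler_norm_sum _ _ _) _.
rewrite (bigID (fun C : {set V} => j \in C)) /= [X in _ + X]big1 ?addr0; last first.
  by move=> C /andP[_ jC]; rewrite d0 // mulr0 normr0.
apply: (@le_trans _ _
  (\sum_(C : {set V} | max_clique e C && (j \in C)) (delta * (2 * M)))).
  apply: ler_sum => C /andP[mC jC]; rewrite normrM.
  by apply: ler_pM => //; [exact: hom | exact: local_potential_diff].
rewrite sumr_const -[leLHS]mulr_natl ler_wpM2r ?mulr_ge0 //.
rewrite ler_nat (leq_trans _ (leq_bigmax j)) //.
by apply/eq_leq/eq_card => C; rewrite inE.
Qed.

End WeightedPotential.

Lemma num_updates_le_gain (R : realType) (V : finType) (S : V -> finType)
    (u : V -> profile S -> R) (Psi : profile S -> R) (i : V)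
    (L : nat) (a : nat -> profile S) :
  better_response_path u L a ->
  (forall j x y, differ_exactly_at j x y -> u j x < u j y ->
     (j == i)%:R <= Psi y - Psi x) ->
  (num_updates i L a)%:R <= Psi (a L) - Psi (a 0%N).
Proof.
move=> ha gain; rewrite -(telescope_sumr (fun t => Psi (a t))) // big_mkord.
rewrite /num_updates -sum1_card big_mkcond natr_sum /=.
apply: ler_sum => t _; have [j [dj lt_u]] := ha t (ltn_ord t).
apply: le_trans (gain j _ _ dj lt_u); rewrite inE.
(* The updating coordinate is unique, so a step counted for [i] has [j = i]. *)
case: ifP => //= /forallP/(_ j) di; have /forallP/(_ j) := dj.
by rewrite (eqP di) eqxx => /eqP ->.
Qed.

(** * The bound on the number of updates *)

Theorem corollary5p6 (R : realType) (M c : R) (hM : 1 <= M) (hc : 0 < c)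
    (V : finType) (e : rel V) (e_sym : symmetric e) (e_irr : irreflexive e)
    (D : nat) (hD : clique_degree e = D)
    (growth : forall (i : V) (r : nat),
       #|sphere e r i|%:R <= c * (1 + 1 / (4 * D%:R * M)) ^+ r)
    (S : V -> finType) (u : V -> profile S -> R)
    (Phi : profile S -> R) (phi : forall C : {set V}, local_profile S C -> R)
    (hgraphical : graphical_game e u)
    (hpotential : potential_game u Phi)
    (hdecomp : decomposes e Phi phi)
    (hbounded : bounded_local_potentials e M phi)
    (hintegral : integral_local_potentials e phi)
    (L : nat) (a : nat -> profile S) (ha : better_response_path u L a)
    (i : V) :
  (num_updates i L a)%:R <= 8 * c * D%:R ^+ 2 * M ^+ 2.
Proof.
have D1 : 1 <= D%:R :> R by rewrite ler1n -hD; exact: clique_degree_gt0.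
have M0 : 0 <= M by lra.
set d : R := D%:R in D1 growth *.
set x := 1 / (4 * d * M) in growth.
have dM1 : 1 <= d * M by nra.
have xE : 4 * d * M * x = 1.
  by rewrite /x mulrC divfK //; apply/eqP; nra.
have x0 : 0 < x by rewrite /x divr_gt0 //; nra.
(* From here on [x] enters only through [4 * d * M * x = 1], its sign and the growth bound. *)
clearbody x.
have x4 : 4 * x <= 1 by nra.
pose mu : R := 1 + 4 * x; have mu1 : 1 <= mu by rewrite /mu; lra.
have nuE : mu^-1 * mu = 1 by rewrite mulVf // gt_eqF //; lra.
have nu0 : 0 <= mu^-1 by rewrite invr_ge0; lra.
have nu1 : mu^-1 <= 1 by rewrite invf_le1 //; lra.
pose w := dist_weight e i mu^-1; pose om := clique_weight w.
have w0 j : 0 <= w j by exact: dist_weight_ge0.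
have om_ge (C : {set V}) j : j \in C -> w j <= om C by exact: clique_weight_ge.
have om_le (C : {set V}) j : max_clique e C -> j \in C -> om C <= mu * w j.
  move=> mC jC; apply: clique_weight_le => [|k kC].
    by rewrite mulr_ge0 //; lra.
  (* Any other vertex of the clique is adjacent to [j], so its weight is at most [mu * w j]. *)
  have [<-|jk] := eqVneq j k; first by rewrite ler_peMl.
  have ekj : e k j by rewrite e_sym (max_clique_edge mC).
  have step : mu^-1 * w k <= w j by exact: dist_weight_step.
  have -> : w k = mu * (mu^-1 * w k) by rewrite mulrA [mu * _]mulrC nuE mul1r.
  by rewrite ler_wpM2l //; lra.
have gain j s t : differ_exactly_at j s t -> u j s < u j t ->
    (j == i)%:R <= weighted_potential e phi om t - weighted_potential e phi om s.
  move=> dst lt_u.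
  have wgain := weighted_potential_gain hbounded hpotential hdecomp hintegral
    M0 _ _ _ dst lt_u.
  have [ji|_] := eqVneq j i.
  (* Cliques through [i] have weight exactly 1, the largest possible, so there is no error term. *)
  - apply: le_trans (wgain om 1 0 ler01 (lexx 0) _).
      by rewrite mul0r mulr0 subr0.
    move=> C mC; rewrite ji => iC; have -> : om C = 1; last by rewrite subrr normr0.
    apply/eqP; rewrite eq_le clique_weight_le //=; last first.
      by move=> k _; exact: dist_weight_le1.
    by rewrite -(dist_weight_center e i mu^-1) om_ge.
  (* Midpoint and half-length of the interval from [w j] to [mu * w j]; the error term is then
     exactly [w j]. *)
  - apply: le_trans (wgain om ((1 + 2 * x) * w j) (2 * x * w j) _ _ _).
    + have -> : (clique_degree e)%:R = d by rewrite hD.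
      have -> : d * (2 * x * w j * (2 * M)) = 4 * d * M * x * w j by ring.
      by rewrite xE mulrDl addrAC subrr add0r !mulr_ge0 //; lra.
    + by rewrite mulr_ge0 //; lra.
    + by rewrite !mulr_ge0 //; lra.
    + move=> C mC jC; have := om_ge C j jC; have := om_le C j mC jC.
      by rewrite /mu ler_norml => h1 h2; apply/andP; split; lra.
apply: le_trans (num_updates_le_gain ha gain) _.
apply: le_trans (weighted_potential_range hbounded _ _ _) _.
  by move=> C; exact: clique_weight_ge0.
have sum_w : \sum_j w j <= c * (4 * d * M).
  rewrite sum_dist_weight.
  apply: (@le_trans _ _ (\sum_(r < #|V|) c * ((1 + x) * mu^-1) ^+ r)).
    apply: ler_sum => r _; rewrite exprMn mulrA.
    by rewrite ler_wpM2r ?exprn_ge0.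
  rewrite -mulr_sumr ler_wpM2l //; first by lra.
  (* Here [4 * d * M] is [1 / x] and one minus the ratio is [3 * x / mu], so the condition reads
     [mu <= 3]; it follows from [4 * x <= 1]. *)
  apply: sum_geometric_le.
    by rewrite mulr_ge0 ?ltr_pdivrMr /mu //; lra.
  have -> : 1 - (1 + x) * mu^-1 = 3 * x * mu^-1.
    by rewrite -[X in X - _]nuE /mu; ring.
  have -> : 3 * x * mu^-1 * (4 * d * M) = 3 * (4 * d * M * x) * mu^-1 by ring.
  rewrite xE mulr1 ler_pdivlMr; last by lra.
  by rewrite /mu; lra.
have sum_om := sum_clique_weight w0 e; rewrite hD -/d -/om in sum_om.
apply: (@le_trans _ _ (2 * M * (d * (c * (4 * d * M))))).
  rewrite ler_wpM2l //; first by lra.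
  by apply: le_trans sum_om _; rewrite ler_wpM2l //; lra.
by rewrite le_eqVlt; apply/orP; left; apply/eqP; ring.
Qed.
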